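(* Let $\theta=(\eta,\Psi)\in\mathcal{M}_{LME}$, $\Psi=(\Psi_1,\dots,\Psi_K)$. The Riemannian gradient $\operatorname{grad} L_R(\theta)\in T_\theta\mathcal{M}_{LME}$ of the objective $$L_R(\theta)=(n-p)\,\eta+\log\det(H)+\log\det(X^TH^{-1}X)+\frac{y^TP(H)y}{\exp(\eta)}$$ is given by $$\operatorname{grad}L_R(\theta)=\begin{pmatrix}\chi_\eta\\ \chi_\Psi\end{pmatrix},\qquad \chi_\Psi=(\chi_{\Psi_1},\dots,\chi_{\Psi_K}),$$ where $$\chi_\eta=(n-p)-\frac{y^TP(H)y}{\exp(\eta)},\qquad \chi_{\Psi_j}=\Psi_j\sum_{l_j=1}^{M_j}{Z^{(j,l_j)}}^T\,\operatorname{grad}^e_H L_R(\theta)\,Z^{(j,l_j)}\,\Psi_j\quad (j=1,\dots,K),$$ with $$\operatorname{grad}^e_H L_R(\theta)=P(H)+\frac{1}{\exp(\eta)}\operatorname{grad}^e_H\big(y^TP(H)y\big),$$ $$\operatorname{grad}^e_H\big(y^TP(H)y\big)=-H^{-1}yy^TH^{-1}+H^{-1}yv_1^TH^{-1}+H^{-1}v_1y^TH^{-1}-H^{-1}X(X^TH^{-1}X)^{-1}X^Tv_2v_2^TX(X^TH^{-1}X)^{-1}X^TH^{-1},$$ and $v_1=X(X^TH^{-1}X)^{-1}X^TH^{-1}y$, $v_2=H^{-1}y$.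
   Context: Data: $n,p,K$ and $M_j,q_j$ ($j=1,\dots,K$) are positive integers; $X\in\mathbb{R}^{n\times p}$, $y\in\mathbb{R}^n$, and $Z^{(j,l_j)}\in\mathbb{R}^{n\times q_j}$ for $j=1,\dots,K$, $l_j=1,\dots,M_j$ are given. $X$ has full column rank, so that $X^TH^{-1}X$ is invertible for every symmetric positive definite $H$. Manifold: $\mathbb{P}^d$ is the set of real symmetric positive definite $d\times d$ matrices, an open subset of the space $\mathbb{S}^d$ of real symmetric $d\times d$ matrices, so its tangent space at each point is $\mathbb{S}^d$. Put $\mathcal{M}_{LME}=\mathbb{R}\times\mathbb{P}^{q_1}\times\dots\times\mathbb{P}^{q_K}$, with points $\theta=(\eta,\Psi)$, $\Psi=(\Psi_1,\dots,\Psi_K)$, and tangent space $T_\theta\mathcal{M}_{LME}=\mathbb{R}\times\mathbb{S}^{q_1}\times\dots\times\mathbb{S}^{q_K}$. The Riemannian metric is the product of the Euclidean metric on $\mathbb{R}$ and the affine-invariant metrics: $$\langle\xi,\chi\rangle_\theta=\xi_\eta\chi_\eta+\sum_{j=1}^K\operatorname{tr}\big(\Psi_j^{-1}\xi_{\Psi_j}\Psi_j^{-1}\chi_{\Psi_j}\big).$$ The Riemannian gradient $\operatorname{grad}f(\theta)$ of a smooth $f:\mathcal{M}_{LME}\to\mathbb{R}$ is the unique tangent vector with $\langle\operatorname{grad}f(\theta),\xi\rangle_\theta=\mathrm{D}f(\theta)[\xi]$ for all $\xi\in T_\theta\mathcal{M}_{LME}$. Functions: for $\theta\in\mathcal{M}_{LME}$,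 $$H=I_n+\sum_{j=1}^K\sum_{l_j=1}^{M_j}Z^{(j,l_j)}\Psi_j{Z^{(j,l_j)}}^T\in\mathbb{P}^n,\qquad P(H)=H^{-1}-H^{-1}X(X^TH^{-1}X)^{-1}X^TH^{-1}.$$ Euclidean gradients with respect to $H$: the right-hand side defining $L_R$ (with $\eta$ fixed), and likewise $y^TP(H)y$, is regarded as a function of the matrix $H$, defined by the same formula on a neighbourhood of $\mathbb{P}^n$ in $\mathbb{R}^{n\times n}$. $\operatorname{grad}^e_H$ denotes its gradient with respect to the Euclidean inner product $\operatorname{tr}(A^TB)$ on $\mathbb{R}^{n\times n}$, evaluated at the symmetric positive definite matrix $H$ above. *)

(* Defs.v *)
From HB Require Import structures.
From mathcomp Require Import all_boot all_order all_algebra.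
From mathcomp Require Import all_classical all_reals all_analysis.
Export numFieldNormedType.Exports.

Set Implicit Arguments.
Unset Strict Implicit.
Unset Printing Implicit Defensive.

Import Order.TTheory GRing.Theory Num.Theory.
Local Open Scope classical_set_scope.
Local Open Scope ring_scope.

(* The space of real symmetric matrices, with the norm of ['M[R]_d] restricted
   to it. *)
Section SymmetricMatrices.
Context (R : realType) (d : nat).

Definition is_symmx : pred 'M[R]_d := fun A => A^T == A.

Record symM := SymM { mx_of_symM :> 'M[R]_d ; _ : is_symmx mx_of_symM }.

HB.instance Definition _ := [isSub for mx_of_symM].
HB.instance Definition _ := [Choice of symM by <:].

Fact is_symmx_submod : submod_closed is_symmx.
Proof.
split; first by rewrite unfold_in /is_symmx trmx0.
move=> a A B; rewrite !unfold_in /is_symmx => /eqP At /eqP Bt.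
by rewrite linearP /= At Bt.
Qed.

HB.instance Definition _ :=
  GRing.isSubmodClosed.Build R 'M[R]_d is_symmx is_symmx_submod.
HB.instance Definition _ := [SubChoice_isSubLmodule of symM by <:].

Let symM_norm (A : symM) : R := `|\val A|.

Fact symM_ler_normD A B : symM_norm (A + B) <= symM_norm A + symM_norm B.
Proof. by rewrite /symM_norm raddfD ler_normD. Qed.

Fact symM_normrZ (a : R) A : symM_norm (a *: A) = `|a| * symM_norm A.
Proof. by rewrite /symM_norm linearZ /= normrZ. Qed.

Fact symM_normr0_eq0 A : symM_norm A = 0 -> A = 0.
Proof. by move=> /normr0_eq0 A0; apply: val_inj; rewrite A0 raddf0. Qed.

HB.instance Definition _ :=
  Lmodule_isNormed.Build R symM symM_ler_normD symM_normrZ symM_normr0_eq0.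

End SymmetricMatrices.

(* Finite product of a dependent family of normed modules, with the sum norm:
   the library only has binary and non-dependent products. *)
Section DependentProduct.
Context (R : realType) (I : finType) (V : I -> normedModType R).

Definition dprodmod : Type := forall i, V i.

HB.instance Definition _ := gen_eqMixin dprodmod.
HB.instance Definition _ := gen_choiceMixin dprodmod.

Let dprod0 : dprodmod := fun i => 0.
Let dprod_opp (u : dprodmod) : dprodmod := fun i => - u i.
Let dprod_add (u v : dprodmod) : dprodmod := fun i => u i + v i.
Let dprod_scale (a : R) (u : dprodmod) : dprodmod := fun i => a *: u i.

Fact dprod_addA : associative dprod_add.
Proof. by move=> u v w; apply: functional_extensionality_dep => i; apply: addrA. Qed.
Fact dprod_addC : commutative dprod_add.
Proof. by move=> u v; apply: functional_extensionality_dep => i; apply: addrC. Qed.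
Fact dprod_add0 : left_id dprod0 dprod_add.
Proof. by move=> u; apply: functional_extensionality_dep => i; apply: add0r. Qed.
Fact dprod_addN : left_inverse dprod0 dprod_opp dprod_add.
Proof. by move=> u; apply: functional_extensionality_dep => i; apply: addNr. Qed.

HB.instance Definition _ :=
  GRing.isZmodule.Build dprodmod dprod_addA dprod_addC dprod_add0 dprod_addN.

Fact dprod_scaleA a b u : dprod_scale a (dprod_scale b u) = dprod_scale (a * b) u.
Proof. by apply: functional_extensionality_dep => i; apply: scalerA. Qed.
Fact dprod_scale1 : left_id 1 dprod_scale.
Proof. by move=> u; apply: functional_extensionality_dep => i; apply: scale1r. Qed.
Fact dprod_scaleDr : right_distributive dprod_scale +%R.
Proof. by move=> a u v; apply: functional_extensionality_dep => i; apply: scalerDr. Qed.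
Fact dprod_scaleDl u : {morph dprod_scale^~ u : a b / a + b}.
Proof. by move=> a b; apply: functional_extensionality_dep => i; apply: scalerDl. Qed.

HB.instance Definition _ := GRing.Zmodule_isLmodule.Build R dprodmod
  dprod_scaleA dprod_scale1 dprod_scaleDr dprod_scaleDl.

Let dprod_norm (u : dprodmod) : R := \sum_i `|u i|.

Fact dprod_ler_normD u v : dprod_norm (u + v) <= dprod_norm u + dprod_norm v.
Proof. by rewrite /dprod_norm -big_split ler_sum // => i _; apply: ler_normD. Qed.

Fact dprod_normrZ (a : R) u : dprod_norm (a *: u) = `|a| * dprod_norm u.
Proof. by rewrite /dprod_norm mulr_sumr; apply: eq_bigr => i _; apply: normrZ. Qed.

Fact dprod_normr0_eq0 u : dprod_norm u = 0 -> u = 0.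
Proof.
move=> /psumr_eq0P u0; apply: functional_extensionality_dep => i.
by apply/normr0_eq0/u0.
Qed.

HB.instance Definition _ := Lmodule_isNormed.Build R dprodmod
  dprod_ler_normD dprod_normrZ dprod_normr0_eq0.

End DependentProduct.

Definition posdefmx (R : realType) (d : nat) (A : 'M[R]_d) : Prop :=
  A^T = A /\ forall u : 'cV[R]_d, u != 0 -> 0 < (u^T *m A *m u) 0 0.

(* R x S^(q_1) x ... x S^(q_K): the vector space of which the manifold is an
   open subset, hence also its tangent space at every point. *)
Notation lme_space R q :=
  (R * dprodmod (fun j => symM R (q j)))%type.

Definition lme_manifold (R : realType) (K : nat) (q : 'I_K -> nat) :
    set (lme_space R q) :=
  [set theta : lme_space R q | forall j, posdefmx (theta.2 j)].

Definition lme_metric (R : realType) (K : nat) (q : 'I_K -> nat)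
    (theta xi chi : lme_space R q) : R :=
  xi.1 * chi.1 +
  \sum_(j < K) \tr (invmx (theta.2 j) *m xi.2 j *m invmx (theta.2 j) *m chi.2 j).

(* [G] is the Riemannian gradient of [f] at [theta]: since the manifold is open
   in [lme_space R q], D f(theta) is the Frechet differential there. *)
Definition is_rgrad (R : realType) (K : nat) (q : 'I_K -> nat)
    (f : lme_space R q -> R) (theta G : lme_space R q) : Prop :=
  differentiable f theta /\
  unique (fun G' => forall xi, lme_metric theta G' xi = 'd f theta xi) G.

(* [G] is the gradient of [f] at [H] for the inner product tr(A^T B) on the
   space of all (not only symmetric) square matrices. *)
Definition is_egrad (R : realType) (n : nat)
    (f : 'M[R]_n -> R) (H G : 'M[R]_n) : Prop :=
  differentiable f H /\
  unique (fun G' : 'M[R]_n => forall D, \tr (G'^T *m D) = 'd f H D) G.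

Definition lme_H (R : realType) (n K : nat) (M q : 'I_K -> nat)
    (Z : forall j, 'I_(M j) -> 'M[R]_(n, q j))
    (Psi : dprodmod (fun j : 'I_K => symM R (q j))) : 'M[R]_n :=
  1%:M + \sum_(j < K) \sum_(l < M j) Z j l *m Psi j *m (Z j l)^T.

Definition lme_P (R : realType) (n p : nat) (X : 'M[R]_(n, p)) (H : 'M[R]_n) :
    'M[R]_n :=
  invmx H -
  invmx H *m X *m invmx (X^T *m invmx H *m X) *m X^T *m invmx H.

Definition lme_yPy (R : realType) (n p : nat) (X : 'M[R]_(n, p)) (y : 'cV[R]_n)
    (H : 'M[R]_n) : R :=
  (y^T *m lme_P X H *m y) 0 0.

(* The objective as a function of [H], with [eta] fixed. *)
Definition lme_LR_of_H (R : realType) (n p : nat) (X : 'M[R]_(n, p))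
    (y : 'cV[R]_n) (eta : R) (H : 'M[R]_n) : R :=
  (n%:R - p%:R) * eta + ln (\det H) + ln (\det (X^T *m invmx H *m X)) +
  lme_yPy X y H / expR eta.

Definition lme_LR (R : realType) (n p K : nat) (M q : 'I_K -> nat)
    (X : 'M[R]_(n, p)) (y : 'cV[R]_n)
    (Z : forall j, 'I_(M j) -> 'M[R]_(n, q j)) (theta : lme_space R q) : R :=
  lme_LR_of_H X y theta.1 (lme_H Z theta.2).

(* Main.v *)
(* Writing S = H^-1 and W = (X^T S X)^-1, the rule d(H^-1) = - S dH S and
   Jacobi's formula give
     dP = - P dH P  and  d(log det H + log det (X^T S X)) = tr (P dH),
   so that y^T P y has Euclidean gradient - (P y) (P y)^T, where
   P y = S y - S v1.  The chain rule along the affine map Psi |-> H(Psi) then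
   yields the differential of L_R, and the affine-invariant metric is
   nondegenerate, with tr (Psi^-1 (Psi A Psi) Psi^-1 xi) = tr (A xi). *)
From HB Require Import structures.
Require Import Defs.
From mathcomp Require Import all_boot all_order all_algebra perm ring.
From mathcomp Require Import all_classical all_reals all_analysis.

Set Implicit Arguments.
Unset Strict Implicit.
Unset Printing Implicit Defensive.

Import Order.TTheory GRing.Theory Num.Theory.
Local Open Scope classical_set_scope.
Local Open Scope ring_scope.

(** * Differential calculus of matrix-valued functions *)

Section Differentials.
Context (R : realType) (V W : normedModType R).

(** The differential is local: the first-order expansion of [f] at [x] is also one of [g], and
    expansions are unique. This serves functions such as [invmx], handled through a formula valid
    only on a neighbourhood. *)
Lemma is_diff_near_eq (f g df : V -> W) x :
  (\near x, f x = g x) -> is_diff x f df -> is_diff x g df.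
Proof.
move=> fg dfx.
have fgx : f x = g x := nbhs_singleton fg.
have cf : continuous ('d f x) by apply: diff_continuous; exact: ex_diff.
have g_loc : g \o shift x = cst (g x) + 'd f x +o_ 0 id.
  apply/eqaddoP => e e0.
  have /diff_locally/eqaddoP/(_ _ e0) fe : differentiable f x by exact: ex_diff.
  move: fg; rewrite (near_shift 0) subr0 => fg.
  near=> h.
  have fgh : f (h + x) = g (h + x) by near: h; exact: fg.
  rewrite !fctE /= -fgh -fgx.
  by near: h; exact: fe.
have dg := diff_unique cf g_loc.
apply: DiffDef; last by rewrite dg diff_val.
by apply/diff_locallyP; rewrite dg.
Unshelve. all: by end_near. Qed.

Lemma is_diff_linear (f : {linear V -> W}) x : continuous f -> is_diff x f f.
Proof.
by move=> cf; apply: DiffDef; [exact: linear_differentiable|exact: diff_lin].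
Qed.

Lemma is_diff_sum (I : Type) (r : seq I) (f df : I -> V -> W) x :
  (forall i, is_diff x (f i) (df i)) ->
  is_diff x (fun v => \sum_(i <- r) f i v) (fun v => \sum_(i <- r) df i v).
Proof.
move=> dfx; elim: r => [|i r IH].
  under eq_fun do rewrite big_nil.
  under [X in is_diff_def _ _ X]eq_fun do rewrite big_nil.
  exact: is_diff_cst.
under eq_fun do rewrite big_cons.
under [X in is_diff_def _ _ X]eq_fun do rewrite big_cons.
exact: is_diffD.
Qed.

End Differentials.

Lemma is_diff_fst (R : realType) (V W : normedModType R) (x : V * W) :
  is_diff x fst fst.
Proof.
apply: (@is_diff_linear _ _ _ fst).
by move=> z; exact: cvg_fst.
Qed.

Lemma differentiable_prod (R : realType) (V : normedModType R) (I : Type)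
    (r : seq I) (f : I -> V -> R) x :
  (forall i, differentiable (f i) x) ->
  differentiable (fun v => \prod_(i <- r) f i v) x.
Proof.
move=> dfx; elim: r => [|i r IH].
  under eq_fun do rewrite big_nil.
  exact: differentiable_cst.
under eq_fun do rewrite big_cons.
exact: differentiableM.
Qed.

(** * Entrywise rules for matrix-valued maps *)

Section MatrixDifferentials.
Context (R : realType) (V : normedModType R).

Lemma is_diff_coord m n (f df : V -> 'M[R]_(m, n)) x i j :
  is_diff x f df -> is_diff x (fun v => f v i j) (fun v => df v i j).
Proof.
move=> dfx; pose c (A : 'M[R]_(m, n)) := A i j.
have c_lin : linear c by move=> a A B; rewrite /c !mxE.
pose cM := GRing.isLinear.Build _ _ _ _ _ c_lin.
pose cL : {linear _ -> _} := HB.pack c cM.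
have := @is_diff_linear _ _ _ cL (f x) (@coord_continuous _ _ _ i j).
exact: is_diff_comp.
Qed.

(** Expansion in the basis [delta_mx i j] reduces the claim to scalar functions followed by the
    linear maps [a |-> a *: delta_mx i j]. *)
Lemma is_diff_matrix m n (f df : V -> 'M[R]_(m, n)) x :
  (forall i j, is_diff x (fun v => f v i j) (fun v => df v i j)) ->
  is_diff x f df.
Proof.
move=> dfx.
have sum_delta (g : V -> 'M[R]_(m, n)) :
    g = fun v => \sum_i \sum_j g v i j *: delta_mx i j.
  by apply/funext => v; exact: matrix_sum_delta.
rewrite (sum_delta f) (sum_delta df).
apply: is_diff_sum => i; apply: is_diff_sum => j.
apply: (@is_diff_comp _ _ _ _ (fun v => f v i j) (fun v => df v i j)
  ( *:%R ^~ (delta_mx i j)) ( *:%R ^~ (delta_mx i j))).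
Qed.

Lemma is_diff_mulmx m n p (f df : V -> 'M[R]_(m, n)) (g dg : V -> 'M[R]_(n, p))
    x : is_diff x f df -> is_diff x g dg ->
  is_diff x (fun v => f v *m g v) (fun v => df v *m g x + f x *m dg v).
Proof.
move=> dfx dgx; apply: is_diff_matrix => i j.
have dS : is_diff x (fun v => \sum_k f v i k * g v k j)
    (fun v => \sum_k (f x i k * dg v k j + g x k j * df v i k)).
  by apply: is_diff_sum => k; apply: is_diffM; exact: is_diff_coord.
have -> : (fun v => (f v *m g v) i j) = fun v => \sum_k f v i k * g v k j.
  by apply/funext => v; rewrite mxE.
apply: (is_diff_eq dS); apply/funext => v; rewrite !mxE -big_split /=.
by apply: eq_bigr => k _; rewrite addrC [df _ _ _ * _]mulrC.
Qed.

Lemma is_diff_mulmxl m n p (f df : V -> 'M[R]_(m, n)) (B : 'M[R]_(n, p)) x :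
  is_diff x f df -> is_diff x (fun v => f v *m B) (fun v => df v *m B).
Proof.
move=> dfx; apply: is_diff_eq.
  by apply: is_diff_mulmx; exact: is_diff_cst.
by apply/funext => v; rewrite mulmx0 addr0.
Qed.

Lemma is_diff_mulmxr m n p (f df : V -> 'M[R]_(n, p)) (B : 'M[R]_(m, n)) x :
  is_diff x f df -> is_diff x (fun v => B *m f v) (fun v => B *m df v).
Proof.
move=> dfx; apply: is_diff_eq.
  by apply: is_diff_mulmx; exact: is_diff_cst.
by apply/funext => v; rewrite mul0mx add0r.
Qed.

(** By the Leibniz formula the determinant is a signed sum of products of entries. The value of the
    differential is computed separately in [is_diff_det]. *)
Lemma differentiable_det n (f : V -> 'M[R]_n) x :
  (forall i j, differentiable (fun v => f v i j) x) ->
  differentiable (fun v => \det (f v)) x.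
Proof.
move=> dfx.
have dprod (s : 'S_n) := differentiable_prod (index_enum 'I_n)
  (fun i => dfx i (s i)).
have dS := is_diff_sum (index_enum _)
  (fun s : 'S_n => is_diffZ ((-1) ^+ s) (differentiableP (dprod s))).
exact: (@ex_diff _ _ _ _ _ _ _ dS).
Qed.

End MatrixDifferentials.

(** * Differentials of the determinant and of the inverse *)

Section DetInv.
Context (R : realType) (n : nat).
Implicit Types A D : 'M[R]_n.

(* [cofactor i j] does not depend on row [i], so [det] is affine along
   [delta_mx i j] with slope [cofactor i j A]. *)
Lemma det_add_delta A i j a :
  \det (a *: delta_mx i j + A) = a * cofactor A i j + \det A.
Proof.
rewrite !(expand_det_row _ i) (bigD1 j) //= [X in _ = _ + X](bigD1 j) //= addrA.
have cof k : cofactor (a *: delta_mx i j + A) i k = cofactor A i k.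
  rewrite /cofactor; congr (_ * \det _); apply/matrixP => s t.
  by rewrite !mxE eq_sym (negbTE (neq_lift _ _)) /= mulr0 add0r.
congr (_ + _).
  by rewrite cof !mxE !eqxx mulr1 mulrDl.
apply: eq_bigr => k kj; rewrite cof !mxE (negbTE kj) andbF mulr0 add0r //.
Qed.

(** Jacobi's formula: by linearity the differential is determined by its values on the
    [delta_mx i j], which are the cofactors. *)
Lemma is_diff_det A : is_diff A (fun B => \det B) (fun D => \tr (\adj A *m D)).
Proof.
have dA : differentiable (fun B : 'M[R]_n => \det B) A.
  by apply: differentiable_det => i j; exact: differentiable_coord.
apply: DiffDef => //; apply/funext => D.
rewrite {1}(matrix_sum_delta D) linear_sum /=.
transitivity (\sum_i \sum_j D i j * cofactor A i j).
  apply: eq_bigr => i _; rewrite linear_sum; apply: eq_bigr => j _ /=.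
  rewrite linearZ /=; congr (_ * _).
  (* The difference quotient along [delta_mx i j] equals the cofactor for every nonzero increment,
     so its limit is immediate. *)
  rewrite -deriveE //; apply: cvg_lim => //; apply: cvg_near_cst.
  near=> h.
  rewrite /= det_add_delta addrK /GRing.scale /= mulKf //.
  by near: h; exact: nbhs_dnbhs_neq.
rewrite /mxtrace exchange_big /=; apply: eq_bigr => j _; rewrite !mxE.
by apply: eq_bigr => i _; rewrite !mxE mulrC.
Unshelve. all: by end_near. Qed.

(** Cramer's formula gives differentiability; differentiating [B *m invmx B = 1%:M] then determines
    the differential. *)
Lemma is_diff_invmx A : A \in unitmx ->
  is_diff A (@invmx R n) (fun D => - (invmx A *m D *m invmx A)).
Proof.
move=> uA.
have detA0 : \det A != 0 by rewrite -unitfE -unitmxE.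
have ddet : differentiable (fun B : 'M[R]_n => \det B) A.
  by apply: differentiable_det => i j; exact: differentiable_coord.
have near_unit : \near A, A \in unitmx.
  have /differentiable_continuous/cvgr_neq0/(_ detA0) := ddet.
  by apply: filterS => B; rewrite unitmxE unitfE.
have dinv : differentiable (@invmx R n) A.
  (* [invmx] returns a singular matrix unchanged, so agreement with Cramer's formula is claimed only
     near [A], where the determinant stays nonzero. *)
  pose g (B : 'M[R]_n) := (\det B)^-1 *: \adj B.
  have dg : is_diff A g (fun D => \matrix_(i, j) 'd (fun B => g B i j) A D).
    apply: is_diff_matrix => i j.
    under [X in is_diff_def _ _ X]eq_fun do rewrite mxE.
    apply: differentiableP.
    under eq_fun do rewrite /g !mxE.
    apply: differentiableM; first exact: differentiableV.
    apply: differentiableM; first exact: differentiable_cst.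
    apply: differentiable_det => s t.
    under eq_fun do rewrite !mxE.
    exact: differentiable_coord.
  have g_inv : \near A, g A = invmx A.
    by apply: filterS near_unit => B uB; rewrite /g /invmx uB.
  exact: (@ex_diff _ _ _ _ _ _ _ (is_diff_near_eq g_inv dg)).
apply: DiffDef => //; apply/funext => D.
have d1 : is_diff A (fun B : 'M[R]_n => B *m invmx B)
    (fun D => D *m invmx A + A *m 'd (@invmx R n) A D).
  by apply: is_diff_mulmx; exact: differentiableP.
have d2 : is_diff A (fun B : 'M[R]_n => B *m invmx B) 0.
  apply: (@is_diff_near_eq _ _ _ (cst (1%:M : 'M[R]_n))).
  by apply: filterS near_unit => B uB; rewrite mulmxV.
have /(congr1 (fun f : 'M[R]_n -> 'M[R]_n => invmx A *m f D)) :=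
  etrans (esym (@diff_val _ _ _ _ _ _ _ d1)) (@diff_val _ _ _ _ _ _ _ d2).
rewrite /= mulmxDr mulKmx // [X in _ = X]mulmx0 mulmxA addrC.
by move/eqP; rewrite addr_eq0 => /eqP.
Qed.

End DetInv.

(** * Positive definite matrices *)

(** The transpose of a row of [kermx A^T] is a vector killed by [A], so this kernel is zero and
    [A^T] is invertible. *)
Lemma unitmx_ker0 (F : fieldType) n (A : 'M[F]_n) :
  (forall u : 'cV[F]_n, A *m u = 0 -> u = 0) -> A \in unitmx.
Proof.
move=> A0; rewrite -unitmx_tr -row_free_unit -kermx_eq0.
apply/eqP/row_matrixP => i.
rewrite row0; apply: trmx_inj; rewrite trmx0; apply: A0.
by apply: trmx_inj; rewrite trmx_mul trmxK -row_mul mulmx_ker row0 trmx0.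
Qed.

Lemma rank_full_inj (F : fieldType) n p (X : 'M[F]_(n, p)) :
  \rank X = p -> forall u : 'cV[F]_p, X *m u = 0 -> u = 0.
Proof.
move=> rkX u Xu0; apply: trmx_inj.
have Xfree : row_free X^T by rewrite /row_free mxrank_tr rkX.
by apply: (row_free_inj Xfree); rewrite /= -trmx_mul Xu0 !trmx0 mul0mx.
Qed.

Lemma mxtrace_trmul_ge0 (R : realType) m n (A : 'M[R]_(m, n)) :
  0 <= \tr (A^T *m A).
Proof.
apply: sumr_ge0 => j _; rewrite mxE; apply: sumr_ge0 => i _.
by rewrite mxE -expr2 sqr_ge0.
Qed.

(** The trace is the sum of the squares of the entries, that is, the squared Frobenius norm. *)
Lemma mxtrace_trmul_eq0 (R : realType) m n (A : 'M[R]_(m, n)) :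
  \tr (A^T *m A) = 0 -> A = 0.
Proof.
rewrite /mxtrace => trA0; apply/matrixP => i j; rewrite mxE; apply/eqP.
have sq_ge0 k : 0 <= \sum_l A^T k l * A l k.
  by apply: sumr_ge0 => l _; rewrite mxE -expr2 sqr_ge0.
have {}trA0 : \sum_k \sum_l A^T k l * A l k = 0.
  by rewrite -[RHS]trA0; apply: eq_bigr => k _; rewrite mxE.
have /psumr_eq0P sum0 := @psumr_eq0P _ _ _ _ (fun k _ => sq_ge0 k) trA0 j isT.
rewrite -sqrf_eq0 expr2; have := sum0 _ i isT; rewrite mxE => -> // l _.
by rewrite mxE -expr2 sqr_ge0.
Qed.

Section PosDef.
Context (R : realType).

Lemma posdefmx_unit n (A : 'M[R]_n) : posdefmx A -> A \in unitmx.
Proof.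
case=> _ Apos; apply: unitmx_ker0 => u Au0; apply/eqP; apply: contraT => /Apos.
by rewrite -mulmxA Au0 mulmx0 mxE ltxx.
Qed.

Lemma posdefmx1 n : posdefmx (1%:M : 'M[R]_n).
Proof.
split=> [|u u0]; first exact: trmx1.
rewrite mulmx1 -[ltRHS]/(_ 0 0) -trace_mx11 lt_def mxtrace_trmul_ge0 andbT.
by apply: contra_neq u0; exact: mxtrace_trmul_eq0.
Qed.

Lemma posdefmxD n (A B : 'M[R]_n) : posdefmx A -> B^T = B ->
  (forall u : 'cV[R]_n, 0 <= (u^T *m B *m u) 0 0) -> posdefmx (A + B).
Proof.
case=> At Apos Bt Bge0; split=> [|u u0]; first by rewrite raddfD /= At Bt.
by rewrite mulmxDr mulmxDl mxE ltr_wpDr // Apos.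
Qed.

Lemma posdefmxZ n (A : 'M[R]_n) a : 0 < a -> posdefmx A -> posdefmx (a *: A).
Proof.
move=> a0 [At Apos]; split=> [|u u0]; first by rewrite linearZ /= At.
by rewrite -scalemxAr -scalemxAl mxE mulr_gt0 // Apos.
Qed.

Lemma posdefmx_ge0 n (A : 'M[R]_n) (u : 'cV[R]_n) :
  posdefmx A -> 0 <= (u^T *m A *m u) 0 0.
Proof.
case=> _ Apos; have [->|/Apos/ltW//] := eqVneq u 0.
by rewrite mulmx0 mxE.
Qed.

(** The value of the new form at [u] is that of [A] at [X *m u], which is nonzero when [u] is. *)
Lemma posdefmx_congr n p (A : 'M[R]_n) (X : 'M[R]_(n, p)) :
  (forall u : 'cV[R]_p, X *m u = 0 -> u = 0) -> posdefmx A ->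
  posdefmx (X^T *m A *m X).
Proof.
move=> Xinj [At Apos]; split=> [|u u0].
  by rewrite !trmx_mul trmxK At mulmxA.
rewrite !mulmxA -trmx_mul -2!mulmxA mulmxA; apply: Apos.
by apply: contra_neq u0; exact: Xinj.
Qed.

Lemma posdefmx_inv n (A : 'M[R]_n) : posdefmx A -> posdefmx (invmx A).
Proof.
move=> Apos; have uA := posdefmx_unit Apos; have At := Apos.1.
have -> : invmx A = (invmx A)^T *m A *m invmx A.
  by rewrite -mulmxA mulmxV // mulmx1 trmx_inv At.
apply: posdefmx_congr => // u /(congr1 (mulmx A)).
by rewrite mulKVmx // mulmx0.
Qed.

(* The segment from [A] to [1%:M] stays among positive definite, hence
   invertible, matrices, so the determinant keeps its sign along it. *)
Lemma posdefmx_det_gt0 n (A : 'M[R]_n) : posdefmx A -> 0 < \det A.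
Proof.
move=> Apos; rewrite ltNge; apply/negP => detA_le0.
(* With the segment parameter as polynomial variable, the determinant becomes a polynomial. Its
   values at 0 and 1 are [\det A <= 0] and 1, so it has a root [t] in between. *)
pose B : 'M[{poly R}]_n := 'X%:M + (1 - 'X) *: map_mx polyC A.
have detB t : (\det B).[t] = \det (t%:M + (1 - t) *: A).
  rewrite -horner_evalE -det_map_mx; congr (\det _); apply/matrixP => i j.
  rewrite !mxE -[LHS]/(('X *+ (i == j) + (1 - 'X) * (A i j)%:P).[t]).
  by rewrite !hornerE hornerMn hornerX.
have [|t /andP[t0 t1]] := @poly_ivt _ (\det B) 0 1 ler01.
  rewrite !detB subr0 subrr scale1r scale0r addr0 det1 ler01 andbT.
  by rewrite raddf0 add0r.
rewrite rootE detB; apply/negP; rewrite -unitfE -unitmxE; apply: posdefmx_unit.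
(* At [t = 0] the matrix is [A] itself; otherwise [t *: 1%:M] is positive definite and
   [(1 - t) *: A] adds a nonnegative form. *)
have [->|tn0] := eqVneq t 0.
  by rewrite raddf0 add0r subr0 scale1r.
rewrite -scalemx1; apply: posdefmxD.
- by apply: posdefmxZ (posdefmx1 _); rewrite lt_def tn0.
- by rewrite linearZ /= Apos.1.
- move=> u; rewrite -scalemxAr -scalemxAl mxE mulr_ge0 ?subr_ge0 //.
  exact: posdefmx_ge0.
Qed.

Lemma posdefmx_lme_H n K (M q : 'I_K -> nat)
    (Z : forall j, 'I_(M j) -> 'M[R]_(n, q j)) (theta : lme_space R q) :
  lme_manifold theta -> posdefmx (lme_H Z theta.2).
Proof.
move=> thetaP; apply: posdefmxD; first exact: posdefmx1.
  rewrite raddf_sum; apply: eq_bigr => j _ /=; rewrite raddf_sum.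
  apply: eq_bigr => l _ /=.
  by rewrite !trmx_mul trmxK (thetaP j).1 mulmxA.
move=> u; rewrite mulmx_sumr mulmx_suml summxE; apply: sumr_ge0 => j _.
rewrite mulmx_sumr mulmx_suml summxE; apply: sumr_ge0 => l _.
have := posdefmx_ge0 ((Z j l)^T *m u) (thetaP j).
by rewrite trmx_mul trmxK !mulmxA.
Qed.

End PosDef.

(** * Differential of the objective *)

Section Objective.
Context (R : realType) (V : normedModType R).

Lemma is_diff_derive1 (f : R -> R) (x l : R) :
  is_derive x 1 f l -> is_diff x f (fun h => h * l).
Proof.
case=> fx fl; have dfx : differentiable f x by exact/derivable1_diffP.
by apply: DiffDef => //; rewrite diff1E // derive1E fl.
Qed.

(** In Jacobi's formula, the adjugate divided by the determinant is the inverse. *)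
Lemma is_diff_ln_det n (f df : V -> 'M[R]_n) x :
  is_diff x f df -> 0 < \det (f x) ->
  is_diff x (fun v => ln (\det (f v))) (fun v => \tr (invmx (f x) *m df v)).
Proof.
move=> dfx det_gt0.
have dln : is_diff (\det (f x)) (@ln R) (fun h => h * (\det (f x))^-1).
  by apply: is_diff_derive1; exact: is_derive1_ln.
have := is_diff_comp (is_diff_comp dfx (is_diff_det (f x))) dln.
move=> /is_diff_eq; apply; apply/funext => v /=.
by rewrite /invmx unitmxE unitfE gt_eqF //= -scalemxAl linearZ /= mulrC.
Qed.

Lemma is_diff_expRNV (e de : V -> R) x :
  is_diff x e de ->
  is_diff x (fun v => (expR (e v))^-1) (fun v => - (de v / expR (e x))).
Proof.
move=> dex.
have dexp : is_diff (- e x) expR (fun h => h * expR (- e x)).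
  by apply: is_diff_derive1; exact: is_derive_expR.
have := is_diff_comp (is_diffN dex) dexp.
rewrite (_ : _ \o _ = fun v => (expR (e v))^-1); last first.
  by apply/funext => v /=; rewrite expRN.
move=> /is_diff_eq; apply; apply/funext => v /=.
by rewrite expRN mulNr.
Qed.

(** The product rule on [S - S X W X^T S] produces four terms, which are those of the expanded
    product [- P dH P]. *)
Lemma is_diff_lme_P n p (X : 'M[R]_(n, p)) (h dh : V -> 'M[R]_n) x :
  is_diff x h dh -> h x \in unitmx -> X^T *m invmx (h x) *m X \in unitmx ->
  is_diff x (fun v => lme_P X (h v))
    (fun v => - (lme_P X (h x) *m dh v *m lme_P X (h x))).
Proof.
move=> dhx uH uW; set S := invmx (h x); set W := invmx (X^T *m S *m X).
have dS : is_diff x (fun v => invmx (h v)) (fun v => - (S *m dh v *m S)).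
  exact: (is_diff_comp dhx (is_diff_invmx uH)).
have dW : is_diff x (fun v => invmx (X^T *m invmx (h v) *m X))
    (fun v => - (W *m (X^T *m - (S *m dh v *m S) *m X) *m W)).
  exact: (is_diff_comp (is_diff_mulmxl X (is_diff_mulmxr X^T dS))
    (is_diff_invmx uW)).
have dP := is_diffB dS (is_diff_mulmx (is_diff_mulmxl X^T
  (is_diff_mulmx (is_diff_mulmxl X dS) dW)) dS).
apply: (is_diff_eq dP); apply/funext => v.
rewrite /lme_P -/S -/W !fctE.
rewrite !(mulmxN, mulNmx, mulmxDl, mulmxDr, mulmxBl, mulmxBr).
rewrite !(opprK, opprD, mulmxA).
by rewrite -[RHS]addrA; congr (_ + _); rewrite addrC.
Qed.


(** The scalar [- y^T P dH P y] is its own trace, and cyclicity isolates [dH], which exhibits the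
    gradient. *)
Lemma is_diff_lme_yPy n p (X : 'M[R]_(n, p)) (y : 'cV[R]_n)
    (h dh : V -> 'M[R]_n) x (P := lme_P X (h x)) :
  is_diff x h dh -> h x \in unitmx -> X^T *m invmx (h x) *m X \in unitmx ->
  is_diff x (fun v => lme_yPy X y (h v))
    (fun v => \tr (- (P *m y *m y^T *m P) *m dh v)).
Proof.
move=> dhx uH uW.
have := is_diff_coord 0 0
  (is_diff_mulmxl y (is_diff_mulmxr y^T (is_diff_lme_P dhx uH uW))).
move=> /is_diff_eq; apply; apply/funext => v /=; rewrite -/P.
rewrite -[LHS]/(_ 0 0) -trace_mx11 mulmxN !mulNmx !raddfN /=; congr (- _).
rewrite -!mulmxA mxtrace_mulC !mulmxA mxtrace_mulC !mulmxA.
by rewrite mxtrace_mulC !mulmxA mxtrace_mulC !mulmxA.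
Qed.

(** Arbitrary maps [e] and [h] let one computation serve both the Riemannian gradient and, with [e]
    constant and [h] the identity, the Euclidean gradient in [H]. *)
Lemma is_diff_lme_LR n p (X : 'M[R]_(n, p)) (y : 'cV[R]_n)
    (e de : V -> R) (h dh : V -> 'M[R]_n) x (P := lme_P X (h x)) :
  \rank X = p -> posdefmx (h x) -> is_diff x e de -> is_diff x h dh ->
  is_diff x (fun v => lme_LR_of_H X y (e v) (h v))
    (fun v => (n%:R - p%:R - lme_yPy X y (h x) / expR (e x)) * de v +
       \tr ((P - (expR (e x))^-1 *: (P *m y *m y^T *m P)) *m dh v)).
Proof.
move=> rkX hpos dex dhx.
have uH := posdefmx_unit hpos.
have XSXpos := posdefmx_congr (rank_full_inj rkX) (posdefmx_inv hpos).
have uW := posdefmx_unit XSXpos.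
have dlndet := is_diff_ln_det dhx (posdefmx_det_gt0 hpos).
have dS : is_diff x (fun v => invmx (h v)) _ :=
  is_diff_comp dhx (is_diff_invmx uH).
have dlndetX := is_diff_ln_det (is_diff_mulmxl X (is_diff_mulmxr X^T dS))
  (posdefmx_det_gt0 XSXpos).
have dyPy := is_diff_lme_yPy y dhx uH uW.
have dLR := is_diffD (is_diffD (is_diffD (is_diffZ (n%:R - p%:R) dex) dlndet)
  dlndetX) (is_diffM dyPy (is_diff_expRNV dex)).
apply: (is_diff_eq dLR); apply/funext => v; rewrite !fctE /= -/P.
(* The subtracted trace cancels the differential of [ln (\det H)], so the two log-determinants
   together contribute [\tr (P *m dh v)]. *)
have -> : \tr (invmx (X^T *m invmx (h x) *m X) *m
    (X^T *m - (invmx (h x) *m dh v *m invmx (h x)) *m X)) =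
    \tr (P *m dh v) - \tr (invmx (h x) *m dh v).
  rewrite mulmxBl raddfB /= addrAC subrr add0r mulmxN mulNmx mulmxN raddfN /=.
  by rewrite !mulmxA -[X in \tr X]mulmxA mxtrace_mulC !mulmxA.
clearbody P; rewrite mulmxBl -scalemxAl raddfB /= mxtraceZ mulNmx raddfN /=.
rewrite /GRing.scale /=; ring.
Qed.

End Objective.

(** * Gradients *)

Section Gradients.
Context (R : realType).

(** For uniqueness, testing the difference of two gradients against itself shows that its squared
    Frobenius norm is zero. *)
Lemma is_egrad_is_diff n (f : 'M[R]_n -> R) H G :
  is_diff H f (fun D => \tr (G^T *m D)) -> is_egrad f H G.
Proof.
move=> dfH; split; first exact: ex_diff.
split=> [D|G' G'P]; first by rewrite diff_val.
apply/eqP; rewrite -subr_eq0; apply/eqP/mxtrace_trmul_eq0.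
rewrite [(G - G')^T]raddfB mulmxBl [\tr _]raddfB /=.
by rewrite G'P diff_val subrr.
Qed.

(** * The affine-invariant metric and the map from Psi to H *)

Section Manifold.
Context (K : nat) (q : 'I_K -> nat).
Implicit Types theta xi : lme_space R q.

(* Testing [G] against [Psi_j *m G_j *m Psi_j] gives the squared Frobenius norm
   of each [G_j]. *)
Lemma lme_metric_nondegenerate theta G : lme_manifold theta ->
  (forall xi, lme_metric theta G xi = 0) -> G = 0.
Proof.
move=> thetaP G0.
(* Symmetry makes the test matrix an admissible tangent direction. *)
have symS j : is_symmx (theta.2 j *m G.2 j *m theta.2 j).
  rewrite /is_symmx !trmx_mul (thetaP j).1 mulmxA.
  by case: (G.2 j) => A /= /eqP ->.
pose xi : lme_space R q := (G.1, fun j => SymM (symS j)).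
have := G0 xi; rewrite /lme_metric /=.
have trE j : \tr (invmx (theta.2 j) *m G.2 j *m invmx (theta.2 j) *m
    (theta.2 j *m G.2 j *m theta.2 j)) = \tr ((G.2 j)^T *m G.2 j).
  have u := posdefmx_unit (thetaP j).
  rewrite !mulmxA mulmxKV // mxtrace_mulC !mulmxA mulmxV // mul1mx.
  by case: (G.2 j) => A /= /eqP ->.
have tr_ge0 j := mxtrace_trmul_ge0 (G.2 j).
under eq_bigr do rewrite trE.
move=> /eqP; rewrite paddr_eq0 -?expr2 ?sqr_ge0 ?sumr_ge0 // sqrf_eq0.
move=> /andP[/eqP G10 /eqP/psumr_eq0P sum0].
case: G {G0 xi symS trE} G10 tr_ge0 sum0 => [G1 G2] /= -> tr_ge0 sum0.
congr pair; apply: functional_extensionality_dep => j; apply: val_inj.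
by apply: mxtrace_trmul_eq0; exact: sum0.
Qed.

(** Two candidates pair identically with every [xi], so their difference is orthogonal to all [xi]
    and vanishes by nondegeneracy. *)
Lemma is_rgrad_is_diff (f : lme_space R q -> R) theta G : lme_manifold theta ->
  is_diff theta f (lme_metric theta G) -> is_rgrad f theta G.
Proof.
move=> thetaP dft; split; first exact: ex_diff.
split=> [xi|G' G'P]; first by rewrite diff_val.
apply/eqP; rewrite -subr_eq0; apply/eqP/(lme_metric_nondegenerate thetaP) => xi.
have : lme_metric theta G xi - lme_metric theta G' xi = 0.
  by rewrite G'P diff_val subrr.
rewrite /lme_metric => dG; rewrite -[RHS]dG opprD addrACA -mulrBl -sumrB.
congr (_ + _).
by apply: eq_bigr => j _ /=; rewrite -raddfB -!mulmxBl -mulmxBr.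
Qed.

Lemma is_diff_Psi j theta :
  is_diff theta (fun xi : lme_space R q => xi.2 j : 'M[R]_(q j))
    (fun xi => xi.2 j).
Proof.
pose f (xi : lme_space R q) : 'M[R]_(q j) := xi.2 j.
have f_lin : linear f by [].
pose fM := GRing.isLinear.Build _ _ _ _ _ f_lin.
pose fL : {linear _ -> _} := HB.pack f fM.
apply: (@is_diff_linear _ _ _ fL); apply: bounded_linear_continuous.
(* Any [r >= 1] is a bound: the pair norm is a maximum, hence at least the sum norm of the second
   component, which is at least its [j]-th term. *)
apply/linear_boundedP; near=> r => xi.
apply: (@le_trans _ _ `|xi|); last first.
  by rewrite ler_peMl //; near: r; exact: nbhs_pinfty_ge.
rewrite prod_normE le_max; apply/orP; right.
rewrite [leRHS](bigD1 j) //= lerDl; exact: sumr_ge0.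
Unshelve. all: by end_near. Qed.

Lemma is_diff_lme_H n (M : 'I_K -> nat)
    (Z : forall j, 'I_(M j) -> 'M[R]_(n, q j)) theta :
  is_diff theta (fun xi : lme_space R q => lme_H Z xi.2)
    (fun xi => \sum_(j < K) \sum_(l < M j) Z j l *m xi.2 j *m (Z j l)^T).
Proof.
apply: is_diff_eq.
  apply: (@is_diffD _ _ _ (cst 1%:M)); apply: is_diff_sum => j.
  apply: is_diff_sum => l.
  apply: is_diff_mulmxl; apply: is_diff_mulmxr; exact: is_diff_Psi.
by rewrite add0r.
Qed.

End Manifold.
End Gradients.

(** * The gradients of the objective *)

Theorem theorem2 (R : realType) (n p K : nat) (M q : 'I_K -> nat)
    (X : 'M[R]_(n, p)) (y : 'cV[R]_n)
    (Z : forall j : 'I_K, 'I_(M j) -> 'M[R]_(n, q j))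
    (n_gt0 : (0 < n)%N) (p_gt0 : (0 < p)%N) (K_gt0 : (0 < K)%N)
    (M_gt0 : forall j, (0 < M j)%N) (q_gt0 : forall j, (0 < q j)%N)
    (X_full_column_rank : \rank X = p)
    (theta : lme_space R q) (theta_in : lme_manifold theta) :
  let eta := theta.1 in
  let Psi := theta.2 in
  let H := lme_H Z Psi in
  let W := invmx (X^T *m invmx H *m X) in
  let v1 := X *m W *m X^T *m invmx H *m y in
  let v2 := invmx H *m y in
  exists (gradL : lme_space R q) (gradHL gradHy : 'M[R]_n),
    [/\ is_rgrad (lme_LR X y Z) theta gradL,
        is_egrad (lme_LR_of_H X y eta) H gradHL &
        is_egrad (lme_yPy X y) H gradHy] /\
    [/\ gradL.1 = (n%:R - p%:R) - lme_yPy X y H / expR eta,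
        forall j : 'I_K,
          mx_of_symM (gradL.2 j) =
            Psi j *m (\sum_(l < M j) (Z j l)^T *m gradHL *m Z j l) *m Psi j,
        gradHL = lme_P X H + (expR eta)^-1 *: gradHy &
        gradHy =
          - (invmx H *m y *m y^T *m invmx H)
          + invmx H *m y *m v1^T *m invmx H
          + invmx H *m v1 *m y^T *m invmx H
          - invmx H *m X *m W *m X^T *m v2 *m v2^T *m X *m W *m X^T *m invmx H].
Proof.
move=> eta Psi H W v1 v2.
have Hpos : posdefmx H := posdefmx_lme_H Z theta_in.
have uH := posdefmx_unit Hpos.
have uW := posdefmx_unit (posdefmx_congr (rank_full_inj X_full_column_rank)
  (posdefmx_inv Hpos)).
have SX : (invmx H)^T = invmx H by rewrite trmx_inv Hpos.1.
have WT : W^T = W by rewrite trmx_inv !trmx_mul trmxK SX mulmxA.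
set P := lme_P X H.
have PT : P^T = P.
  by rewrite /P /lme_P raddfB /= !trmx_mul trmxK SX -/W WT !mulmxA.
(* The compact form [- (P y) (P y)^T] is the witness; the four-term formula is recovered at the
   end. *)
pose gradHy := - (P *m y *m y^T *m P).
pose gradHL := P + (expR eta)^-1 *: gradHy.
have gradHLE : P - (expR eta)^-1 *: (P *m y *m y^T *m P) = gradHL.
  by rewrite /gradHL scalerN.
have gradHyT : gradHy^T = gradHy.
  by rewrite raddfN /= !trmx_mul trmxK PT !mulmxA.
have gradHLT : gradHL^T = gradHL by rewrite raddfD /= linearZ /= PT gradHyT.
pose S j := \sum_(l < M j) (Z j l)^T *m gradHL *m Z j l.
(* The components of the Riemannian gradient must lie in [symM]; this rests on the symmetry of
   [gradHL]. *)
have symPSP j : is_symmx (Psi j *m S j *m Psi j).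
  rewrite /is_symmx !trmx_mul (theta_in j).1 mulmxA; apply/eqP.
  congr (_ *m _ *m _); rewrite raddf_sum; apply: eq_bigr => l _ /=.
  by rewrite !trmx_mul trmxK gradHLT mulmxA.
pose gradL : lme_space R q :=
  (n%:R - p%:R - lme_yPy X y H / expR eta, fun j => SymM (symPSP j)).
exists gradL, gradHL, gradHy; split; split=> //.
- apply: is_rgrad_is_diff => //.
  have := @is_diff_lme_LR R _ n p X y fst fst (fun xi => lme_H Z xi.2) _ theta
    X_full_column_rank Hpos (is_diff_fst theta) (is_diff_lme_H Z theta).
  move=> /is_diff_eq; apply; apply/funext => xi.
  rewrite /lme_metric /= -/eta -/H -/P; congr (_ + _).
  rewrite mulmx_sumr raddf_sum; apply: eq_bigr => j _ /=.
  have u := posdefmx_unit (theta_in j).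
  (* The inverses in the metric cancel the outer factors [Psi j]; cyclicity of the trace then
     matches the terms for each [l]. *)
  rewrite !mulmxA mulVmx // mul1mx mulmxK // mulmx_suml mulmx_sumr !raddf_sum.
  apply: eq_bigr => l _ /=.
  by rewrite gradHLE !mulmxA mxtrace_mulC !mulmxA.
- apply: is_egrad_is_diff.
  have := @is_diff_lme_LR R _ n p X y (cst eta) 0 id id H
    X_full_column_rank Hpos (is_diff_cst eta H) (is_diff_id H).
  move=> /is_diff_eq; apply; apply/funext => D.
  by rewrite mulr0 add0r -/P gradHLE gradHLT.
- apply: is_egrad_is_diff; rewrite gradHyT.
  exact: (is_diff_lme_yPy y (is_diff_id H) uH uW).
(* Expanding the outer product of [P y = S y - S v1] with itself gives the four terms; in the last
   one, [v1 = X W X^T v2]. *)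
- have Py : P *m y = invmx H *m y - invmx H *m v1.
    by rewrite /P /lme_P mulmxBl !mulmxA.
  have yP : y^T *m P = y^T *m invmx H - v1^T *m invmx H.
    by rewrite -{1}PT -trmx_mul Py raddfB /= !trmx_mul SX.
  rewrite /gradHy -mulmxA yP Py !(mulmxBl, mulmxBr) !opprB.
  rewrite addrC [X in X + _]addrC addrA !mulmxA; congr (_ - _).
  by rewrite /v1 /v2 !trmx_mul trmxK SX WT !mulmxA.
Qed.
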